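(* Let $\mathcal{S}$ be a symmetric unipotent numerical monoid in $G$. Then $|\mathtt{PF}_t(\mathcal{S})|=|\mathtt{F}_t(\mathcal{S})|=1$.
   Context: Setting: $n$ is a positive integer, $\mathbf{U}(n,\mathbb{C})$ is the group of upper triangular unipotent $n\times n$ complex matrices, and $G$ is a (Zariski) closed subgroup of it. $G_{\mathbb{Z}}$ is the group of matrices in $G$ with integer entries, and $G(\mathbb{N})$ is the monoid of matrices in $G_{\mathbb{Z}}$ all of whose entries lie in $\mathbb{N}=\{0,1,2,\dots\}$. Standing assumptions: the monoid $G(\mathbb{N})$ is finitely generated and $G_{\mathbb{Z}}$ is its group completion. $\mathbf{1}_n$ is the identity matrix; for $\mathcal{X}\subseteq G(\mathbb{N})$, $\mathcal{X}^*:=\mathcal{X}\setminus\{\mathbf{1}_n\}$; $A\mathcal{X}:=\{AX\mid X\in\mathcal{X}\}$, and similarly $\mathcal{X}A$. A unipotent numerical monoid in $G$ is a finitely generated submonoid $\mathcal{S}\subseteq G(\mathbb{N})$ (containing $\mathbf{1}_n$) such that $G(\mathbb{N})\setminus\mathcal{S}$ is finite. $\mathcal{S}$ is irreducible if there are no two unipotent numerical monoids $\mathcal{T}_1,\mathcal{T}_2$ in $G$, each properly containing $\mathcal{S}$, with $\mathcal{T}_1\cap\mathcal{T}_2=\mathcal{S}$. $\mathtt{F}_t(\mathcal{S}):=\{A\in G(\mathbb{N})\mid A\notin\mathcal{S},\ A\,G(\mathbb{N})^*\cup G(\mathbb{N})^*A\subseteq\mathcal{S}\}$ (two-sided Frobenius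 set); $\mathtt{PF}_t(\mathcal{S}):=\{A\in G(\mathbb{N})\mid A\notin\mathcal{S},\ A\mathcal{S}^*\cup\mathcal{S}^*A\subseteq\mathcal{S}\}$ (two-sided pseudo-Frobenius set). An irreducible unipotent numerical monoid $\mathcal{S}$ is symmetric if for every $A\in G(\mathbb{N})\setminus\mathcal{S}$ we have $\mathtt{F}_t(\mathcal{S})\cap A\mathcal{S}\neq\emptyset$ or $\mathtt{F}_t(\mathcal{S})\cap\mathcal{S}A\neq\emptyset$.
   Formalization: The monoid S is assumed different from G(N), because S = G(N) is vacuously symmetric and irreducible but has empty two-sided Frobenius and pseudo-Frobenius sets, so the claim fails there. *)

(* Defs.v *)
From HB Require Import structures.
From mathcomp Require Import all_boot all_order all_algebra.
From mathcomp Require Import classical_sets functions cardinality reals complex.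
From mathcomp Require mpoly.

Set Implicit Arguments.
Unset Strict Implicit.
Unset Printing Implicit Defensive.

Import Order.TTheory GRing.Theory Num.Theory.
Local Open Scope classical_set_scope.
Local Open Scope ring_scope.

(* The complex numbers are R[i] for an arbitrary model R : realType of the
   reals. Subgroups and submonoids of U(n, C) are classical sets of matrices,
   with product *m and unit 1%:M. *)

Definition unitriangular (R : realType) (n : nat) : set 'M[R[i]]_n :=
  [set A : 'M[R[i]]_n | forall i j : 'I_n, (j <= i)%N -> A i j = (i == j)%:R].

(* Polynomials in the n * n matrix entries, listed in the order of mxvec. *)
Definition zariski_closed (R : realType) (n : nat) (X : set 'M[R[i]]_n) : Prop :=
  exists P : set (mpoly.mpoly (n * n) R[i]),
    X = [set A : 'M[R[i]]_n | forall p, P p -> mpoly.meval (fun k => mxvec A 0 k) p = 0].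

Definition submonoid (R : realType) (n : nat) (M : set 'M[R[i]]_n) : Prop :=
  M 1%:M /\ forall A B, M A -> M B -> M (A *m B).

Definition unipotent_closed_subgroup (R : realType) (n : nat)
    (G : set 'M[R[i]]_n) : Prop :=
  [/\ G `<=` @unitriangular R n, zariski_closed G, submonoid G
    & forall A, G A -> G (invmx A)].

Definition Zpoints (R : realType) (n : nat) (G : set 'M[R[i]]_n) :
    set 'M[R[i]]_n :=
  G `&` [set A : 'M[R[i]]_n | forall i j, exists m : int, A i j = m%:~R].

Definition Npoints (R : realType) (n : nat) (G : set 'M[R[i]]_n) :
    set 'M[R[i]]_n :=
  G `&` [set A : 'M[R[i]]_n | forall i j, exists m : nat, A i j = m%:R].

Definition fin_gen_monoid (R : realType) (n : nat) (M : set 'M[R[i]]_n) : Prop :=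
  exists2 X : set 'M[R[i]]_n, finite_set X & M = smallest (@submonoid R n) X.

Definition monoid_hom_on (R : realType) (n : nat) (M : set 'M[R[i]]_n)
    (H : groupType) (f : 'M[R[i]]_n -> H) : Prop :=
  f 1%:M = 1%g /\ forall A B, M A -> M B -> f (A *m B) = (f A * f B)%g.

(* Universal property of the inclusion of the monoid M into the group K.
   Homomorphisms are total functions, only their values on M or K matter. *)
Definition is_group_completion (R : realType) (n : nat)
    (M K : set 'M[R[i]]_n) : Prop :=
  M `<=` K /\
  forall (H : groupType) (f : 'M[R[i]]_n -> H), monoid_hom_on M f ->
    exists g : 'M[R[i]]_n -> H,
      [/\ monoid_hom_on K g, {in M, g =1 f}
        & forall h : 'M[R[i]]_n -> H,
            monoid_hom_on K h -> {in M, h =1 f} -> {in K, h =1 g}].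

Definition nonunit (R : realType) (n : nat) (X : set 'M[R[i]]_n) :
    set 'M[R[i]]_n := X `\ 1%:M.

Definition lmulset (R : realType) (n : nat) (A : 'M[R[i]]_n)
    (X : set 'M[R[i]]_n) : set 'M[R[i]]_n := [set A *m B | B in X].

Definition rmulset (R : realType) (n : nat) (X : set 'M[R[i]]_n)
    (A : 'M[R[i]]_n) : set 'M[R[i]]_n := [set B *m A | B in X].

Definition unipotent_numerical_monoid (R : realType) (n : nat)
    (G S : set 'M[R[i]]_n) : Prop :=
  [/\ S `<=` Npoints G, submonoid S, fin_gen_monoid S
    & finite_set (Npoints G `\` S)].

Definition irreducible_monoid (R : realType) (n : nat)
    (G S : set 'M[R[i]]_n) : Prop :=
  ~ exists T1 T2 : set 'M[R[i]]_n,
      [/\ unipotent_numerical_monoid G T1, unipotent_numerical_monoid G T2,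
          S `<` T1, S `<` T2 & T1 `&` T2 = S].

Definition frobenius_set (R : realType) (n : nat) (G S : set 'M[R[i]]_n) :
    set 'M[R[i]]_n :=
  [set A | [/\ Npoints G A, ~ S A
    & lmulset A (nonunit (Npoints G)) `|` rmulset (nonunit (Npoints G)) A
        `<=` S]].

Definition pseudo_frobenius_set (R : realType) (n : nat)
    (G S : set 'M[R[i]]_n) : set 'M[R[i]]_n :=
  [set A | [/\ Npoints G A, ~ S A
    & lmulset A (nonunit S) `|` rmulset (nonunit S) A `<=` S]].

Definition symmetric_monoid (R : realType) (n : nat)
    (G S : set 'M[R[i]]_n) : Prop :=
  [/\ unipotent_numerical_monoid G S, irreducible_monoid G S
    & forall A, (Npoints G `\` S) A ->
        frobenius_set G S `&` lmulset A S !=set0 \/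
        frobenius_set G S `&` rmulset S A !=set0].

(* Main.v *)
Require Import Defs.
From HB Require Import structures.
From mathcomp Require Import all_boot all_order all_algebra.
From mathcomp Require Import classical_sets functions cardinality reals complex.
From mathcomp Require Import boolp.

Local Open Scope classical_set_scope.
Local Open Scope ring_scope.

(** Adjoining a two-sided Frobenius element [A] to [S] gives a unipotent
    numerical monoid, as [A] times any nonunit lies in [S]; two distinct such
    elements would exhibit [S] as a proper intersection, so irreducibility
    leaves at most one. By symmetry a pseudo-Frobenius element [A] has a
    multiple [A *m B] or [B *m A] with [B] in [S] that is Frobenius, hence
    outside [S]; this forces [B = 1], so [A] is itself Frobenius. *)

Section FrobeniusElements.
Set Implicit Arguments.
Unset Strict Implicit.
Variables (R : realType) (n : nat).
Implicit Types (G S : set 'M[R[i]]_n) (A B : 'M[R[i]]_n).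

(** Adding [A] to the generators of [S] suffices: a submonoid containing them contains [S] and [A],
    and minimality can be tested on the submonoid [S] with [A] adjoined. *)
Lemma fin_gen_setU1 S A : fin_gen_monoid S -> submonoid (S `|` [set A]) ->
  fin_gen_monoid (S `|` [set A]).
Proof.
move=> [X finX SX] subSA; exists (X `|` [set A]).
  by rewrite finite_setU; split=> //; exact: finite_set1.
apply/seteqP; split=> [B [SB|->] D [subD XD]|B].
- move: SB; rewrite SX; apply; split=> // C XC; apply: XD; by left.
- by apply: XD; right.
- apply; split=> // C [XC|->]; last by right.
  by left; rewrite SX => D [_]; exact.
Qed.

Lemma frobenius_mull G S A B : frobenius_set G S A -> Npoints G B ->
  B <> 1%:M -> S (A *m B).
Proof. by move=> [_ _ sub] GB B1; apply: sub; left; exists B. Qed.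

Lemma frobenius_mulr G S A B : frobenius_set G S A -> Npoints G B ->
  B <> 1%:M -> S (B *m A).
Proof. by move=> [_ _ sub] GB B1; apply: sub; right; exists B. Qed.

Lemma numerical_monoid_setU1 G S A : unipotent_numerical_monoid G S ->
  frobenius_set G S A -> unipotent_numerical_monoid G (S `|` [set A]).
Proof.
move=> [SG [S1 SM] Sfg Sfin] FA; have [GA nSA _] := FA.
have A1 : A <> 1%:M by move=> A1; apply: nSA; rewrite A1.
have subSA : submonoid (S `|` [set A]).
  split; first by left.
  move=> B C [SB|->] [SC|->].
  - by left; exact: SM.
  - have [->|B1] := pselect (B = 1%:M); first by rewrite mul1mx; right.
    by left; apply: (frobenius_mulr FA) => //; exact: SG.
  - have [->|C1] := pselect (C = 1%:M); first by rewrite mulmx1; right.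
    by left; apply: (frobenius_mull FA) => //; exact: SG.
  (* [A] is itself a nonunit of [Npoints G], so its square falls under its own Frobenius
     condition. *)
  - by left; exact: (frobenius_mull FA).
split=> //.
- by move=> B [/SG//|->].
- exact: fin_gen_setU1.
- by apply: sub_finite_set Sfin => B [GB nB]; split=> // SB; apply: nB; left.
Qed.

Lemma irreducible_frobenius_uniq G S A B : unipotent_numerical_monoid G S ->
  irreducible_monoid G S -> frobenius_set G S A -> frobenius_set G S B -> A = B.
Proof.
move=> numS irrS FA FB; apply: contrapT => AB; apply: irrS.
have proper C : frobenius_set G S C -> S `<` S `|` [set C].
  by move=> [_ nSC _]; split=> [D|SC]; [left|apply: nSC; apply: SC; right].
exists (S `|` [set A]), (S `|` [set B]); split.
- exact: numerical_monoid_setU1.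
- exact: numerical_monoid_setU1.
- exact: proper.
- exact: proper.
(* By distributivity the two extensions meet in [S] together with the intersection of two distinct
   singletons. *)
rewrite -setUIr (_ : [set A] `&` [set B] = set0) ?setU0//.
by apply/seteqP; split=> // C [-> /AB].
Qed.

(** Nonunits of [S] are nonunits of [Npoints G], so fewer products have to be tested. *)
Lemma frobenius_sub_pseudo G S : S `<=` Npoints G ->
  frobenius_set G S `<=` pseudo_frobenius_set G S.
Proof.
move=> SG A FA; have [GA nSA _] := FA; split=> // _ [] [B [SB B1] <-].
- by apply: (frobenius_mull FA) => //; exact: SG.
- by apply: (frobenius_mulr FA) => //; exact: SG.
Qed.

Lemma symmetric_pseudo_sub_frobenius G S : symmetric_monoid G S ->
  pseudo_frobenius_set G S `<=` frobenius_set G S.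
Proof.
move=> [_ _ symS] A [GA nSA sub].
have [[C [FC [B SB BE]]]|[C [FC [B SB BE]]]] := symS A (conj GA nSA);
  subst C; have [_ nSC _] := FC;
  (have [B1|B1] := pselect (B = 1%:M);
    first by move: FC; rewrite B1 ?mul1mx ?mulmx1).
(* Now [B] is a nonunit of [S], so the pseudo-Frobenius condition on [A] would put the Frobenius
   multiple in [S]. *)
- by case: nSC; apply: sub; left; exists B.
- by case: nSC; apply: sub; right; exists B.
Qed.

Lemma symmetric_frobenius_neq0 G S : symmetric_monoid G S ->
  S <> Npoints G -> frobenius_set G S !=set0.
Proof.
move=> [[SG _ _ _] _ symS] SnG.
have [A GSA] : Npoints G `\` S !=set0.
  apply: contrapT => /nonemptyPn; rewrite setD_eq0 => GS; apply: SnG.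
  exact/seteqP.
by case: (symS A GSA) => -[B [FB _]]; exists B.
Qed.

End FrobeniusElements.

(* The hypothesis that S is proper is implicit in the source: the set
   Npoints G itself satisfies the definition of a symmetric monoid, with no
   two-sided Frobenius or pseudo-Frobenius elements. *)
Theorem proposition8p4 (R : realType) (n : nat) (n_gt0 : (0 < n)%N)
    (G : set 'M[R[i]]_n) (G_closed : unipotent_closed_subgroup G)
    (GN_fg : fin_gen_monoid (Npoints G))
    (GZ_completion : is_group_completion (Npoints G) (Zpoints G))
    (S : set 'M[R[i]]_n) (S_sym : symmetric_monoid G S)
    (S_proper : S <> Npoints G) :
  (pseudo_frobenius_set G S #= `I_1)%card /\ (frobenius_set G S #= `I_1)%card.
Proof.
have [numS irrS _] := S_sym; have [SG _ _ _] := numS.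
have [A FA] := symmetric_frobenius_neq0 S_sym S_proper.
have F1 : frobenius_set G S = [set A].
  apply/seteqP; split=> [B FB|_ ->//].
  exact: (irreducible_frobenius_uniq numS irrS).
have -> : pseudo_frobenius_set G S = frobenius_set G S.
  apply/seteqP; split; first exact: symmetric_pseudo_sub_frobenius.
  exact: frobenius_sub_pseudo.
by rewrite F1 card_set1.
Qed.
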